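(* Let $L/K$ be a Galois extension of fields of characteristic $0$ and let $\Gamma_K=(\Gamma,\rho)$ be a connected $K$-rational quiver of type $A$, $D$ or $E$ which splits inside $L/K$ (that is, the $K$-rational structure $\rho$ on the underlying quiver $\Gamma$, which is connected and of type $A$, $D$ or $E$, is given by an action of $\mathrm{Gal}(L/K)$). Then there are no Brauer obstructions for descent of irreducible representations for intermediate fields inside the extension $L/K$; that is: for every intermediate field $K\subseteq F\subseteq L$ and every irreducible representation $W$ of $\Gamma$ over $L$ such that $W^{\sigma}\cong W$ for all $\sigma\in\mathrm{Gal}(L/F)$, there exists an $F$-rational representation of the $F$-rational quiver $\Gamma_F=(\Gamma,\rho|_{\mathrm{Gal}(L/F)})$ whose underlying representation of $\Gamma$ over $L$ is isomorphic to $W$.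
   Context: A quiver $\Gamma=(V,E,s,t)$ consists of finite sets $V$ of vertices and $E$ of edges and source and target maps $s,t\colon E\to V$. It is of type $A$, $D$ or $E$ if its underlying undirected graph is a Dynkin diagram of that type (any orientation allowed). A representation $W$ of $\Gamma$ over a field $L$ consists of $L$-vector spaces $W(v)$, $v\in V$, and $L$-linear maps $W_e\colon W(s(e))\to W(t(e))$, $e\in E$. It is irreducible if it is nonzero and has no subrepresentations other than $0$ and itself. For a Galois extension $L/F$, an $F$-rational structure on $\Gamma$ is a group homomorphism $\rho\colon \mathrm{Gal}(L/F)\to\mathrm{Aut}(\Gamma)$ such that the induced actions on $V$ and $E$ are continuous (for the discrete topology on $V$ and $E$); thus $s(\sigma e)=\sigma s(e)$ and $t(\sigma e)=\sigma t(e)$. The pair $\Gamma_F=(\Gamma,\rho)$ is called an $F$-rational quiver. An $F$-rational representation $M$ of $\Gamma_F$ (with respect to $L/F$) consists of: (1) a family of $L$-vector spaces $M(v)$, $v\in V$; (2) for each $\sigma\in\mathrm{Gal}(L/F)$ a family of $\sigma$-linear isomorphisms $\varphi_{v,\sigma}\colon M(v)\to M(\sigma v)$ satisfying $\varphi_{\tau v,\sigma}\circ\varphi_{v,\tau}=\varphi_{v,\sigma\tau}$; (3) for each $e\in E$ an $L$-linear map $\phi_e\colon M(s(e))\to M(t(e))$, these maps commuting with the Galois action, i.e. $\phi_{\sigma e}\circ\varphi_{s(e),\sigma}=\varphi_{t(e),\sigma}\circ\phi_e$ for all $\sigma,e$. Its underlying representation of $\Gamma$ over $L$ is obtained by forgetting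 the maps $\varphi_{v,\sigma}$. For $\sigma\in\mathrm{Gal}(L/F)$ and a representation $W$ of $\Gamma$ over $L$, the conjugate $W^\sigma$ is defined by $W^\sigma(v)=L\otimes_{\sigma,L}W(\sigma^{-1}v)$ and $(W^\sigma)_e=\mathrm{id}\otimes W_{\sigma^{-1}e}$. *)

(* Defs.v *)
From HB Require Import structures.
From mathcomp Require Import all_boot all_algebra perm.
From mathcomp Require Import separable.
From mathcomp Require Import boolp classical_sets topology.
From mathcomp Require Import freeg.

Set Implicit Arguments.
Unset Strict Implicit.
Unset Printing Implicit Defensive.

Import GRing.Theory.
Local Open Scope ring_scope.
Local Open Scope quotient_scope.

(* An extension L/F is given by an embedding i : {rmorphism F -> L}, a tower  *)
(* K <= F <= L by compatible embeddings.                                      *)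

Section Extensions.
Variables (F L : fieldType) (i : {rmorphism F -> L}).

Definition algebraic_extension : Prop := forall x : L, algebraicOver i x.

Definition splits_over (p : {poly F}) : Prop :=
  exists rs : seq L, map_poly i p %= \prod_(a <- rs) ('X - a%:P).

Definition normal_extension : Prop :=
  forall (p : {poly F}) (x : L),
    irreducible_poly p -> root (map_poly i p) x -> splits_over p.

Definition separable_extension : Prop :=
  forall (p : {poly F}) (x : L),
    irreducible_poly p -> root (map_poly i p) x -> separable_poly p.

(* Possibly of infinite degree. *)
Definition galois_extension : Prop :=
  [/\ algebraic_extension, normal_extension & separable_extension].

End Extensions.

Section GaloisGroup.
Variables (F L : fieldType) (i : {rmorphism F -> L}).

Definition is_gal (f : L -> L) : Prop :=
  [/\ zmod_morphism f, monoid_morphism f, bijective f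
    & forall x, f (i x) = i x].

Record Gal := MkGal { gal_fun :> L -> L; galP : is_gal gal_fun }.

Lemma eq_gal (s t : Gal) : s =1 t -> s = t.
Proof.
case: s t => [f fP] [g gP] /= /funext eqfg; case: g / eqfg gP => gP.
by rewrite (Prop_irrelevance fP gP).
Qed.

HB.instance Definition _ := gen_eqMixin Gal.
HB.instance Definition _ := gen_choiceMixin Gal.

HB.instance Definition _ (s : Gal) :=
  GRing.isZmodMorphism.Build L L s (let: And4 h _ _ _ := galP s in h).
HB.instance Definition _ (s : Gal) :=
  GRing.isMonoidMorphism.Build L L s (let: And4 _ h _ _ := galP s in h).

Lemma gal_bij (s : Gal) : bijective s. Proof. by case: (galP s). Qed.
Lemma gal_fix (s : Gal) x : s (i x) = i x. Proof. by case: (galP s). Qed.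

Lemma is_gal1 : is_gal idfun.
Proof. by split=> //; exists idfun. Qed.

Lemma is_galM (s t : Gal) : is_gal (s \o t).
Proof.
split; first exact: rmorphB.
- by split; [rewrite /= !rmorph1 | move=> x y; rewrite /= !rmorphM].
- exact: bij_comp (gal_bij s) (gal_bij t).
- by move=> x; rewrite /= !gal_fix.
Qed.

Lemma gal_inv_ex (s : Gal) : exists t : Gal, cancel s t /\ cancel t s.
Proof.
have [g sK gK] := gal_bij s; have sI := can_inj sK.
suff gP : is_gal g by exists (MkGal gP).
split.
- by move=> x y; apply: sI; rewrite rmorphB /= !gK.
- by split=> [|x y]; apply: sI; rewrite ?rmorph1 ?rmorphM /= !gK.
- by exists s.
- by move=> x; apply: sI; rewrite gK gal_fix.
Qed.

Definition gal1 := MkGal is_gal1.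
Definition galM (s t : Gal) := MkGal (is_galM s t).
Definition galV (s : Gal) : Gal := projT1 (cid (gal_inv_ex s)).

Lemma galK (s : Gal) : cancel s (galV s).
Proof. by rewrite /galV; case: cid => t []. Qed.
Lemma galKV (s : Gal) : cancel (galV s) s.
Proof. by rewrite /galV; case: cid => t []. Qed.

Fact galMA : associative galM. Proof. by move=> s t u; apply: eq_gal. Qed.
Fact gal1M : left_id gal1 galM. Proof. by move=> s; apply: eq_gal. Qed.
Fact galM1 : right_id gal1 galM. Proof. by move=> s; apply: eq_gal. Qed.
Fact galVM : left_inverse gal1 galV galM.
Proof. by move=> s; apply: eq_gal => x /=; rewrite galK. Qed.
Fact galMV : right_inverse gal1 galV galM.
Proof. by move=> s; apply: eq_gal => x /=; rewrite galKV. Qed.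

HB.instance Definition _ :=
  isGroup.Build Gal galMA gal1M galM1 galVM galMV.

(* The Krull topology: when L/F is algebraic, the s in Gal(L/F) fixing the    *)
(* finite list xs form Gal(L/F(xs)), where F(xs)/F is a finite subextension,  *)
(* and every finite subextension of L/F is generated by such a list.          *)
Definition krull_open : set (set Gal) :=
  fun U => forall s : Gal, U s ->
     exists xs : seq L, forall t : Gal, {in xs, s =1 t} -> U t.

Fact krull_openT : krull_open setT.
Proof. by move=> s _; exists [::]. Qed.

Fact krull_openI : setI_closed krull_open.
Proof.
move=> U V oU oV s [/oU[xs xsU] /oV[ys ysV]]; exists (xs ++ ys) => t eqst.
by split; [apply: xsU | apply: ysV] => x xP; apply: eqst;
   rewrite mem_cat xP ?orbT.
Qed.

Fact krull_open_bigU (I : Type) (f : I -> set Gal) :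
  (forall j, krull_open (f j)) -> krull_open (\bigcup_j f j)%classic.
Proof.
move=> of_ s [j _ /of_[xs xsP]]; exists xs => t /xsP ft.
by exists j.
Qed.

HB.instance Definition _ :=
  isOpenTopological.Build Gal krull_openT krull_openI krull_open_bigU.

Lemma krull_openE : @open Gal = krull_open. Proof. by []. Qed.

End GaloisGroup.

Section GaloisInclusion.
Variables (K F L : fieldType).
Variables (iK : {rmorphism K -> L}) (iF : {rmorphism F -> L}).
Variable j : {rmorphism K -> F}.
Hypothesis tower : forall x, iF (j x) = iK x.

Lemma is_gal_incl (s : Gal iF) : is_gal iK s.
Proof.
case: (galP s) => sB sM s_bij s_fix; split=> // x.
by rewrite -tower s_fix.
Qed.

Definition gal_incl (s : Gal iF) : Gal iK := MkGal (is_gal_incl s).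

Lemma gal_inclM : {morph gal_incl : s t / (s * t)%g >-> (s * t)%g}.
Proof. by move=> s t; apply: eq_gal. Qed.

Lemma gal_incl_continuous : continuous gal_incl.
Proof.
apply/continuousP => U; rewrite !krull_openE => oU s /oU[xs xsP].
by exists xs => t st; apply: xsP.
Qed.

End GaloisInclusion.

(* The base change S (x)_{f,R} X of an R-module X along f : R -> S is the     *)
(* free S-module on the set X modulo the S-submodule generated by the         *)
(* relations 1 (x) (x + y) = 1 (x) x + 1 (x) y and 1 (x) b x = f(b) (x) x.    *)

Section BaseChange.
Variables (R S : comNzRingType) (f : {rmorphism R -> S}) (X : lmodType R).

Inductive tensor_relation : {freeg X / S} -> Prop :=
| TensorRelD x y : tensor_relation (<<x + y>> - (<<x>> + <<y>>))
| TensorRelZ b x : tensor_relation (<<b *: x>> - <<f b *g x>>).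

Definition tensor_relations : {pred {freeg X / S}} :=
  fun u => `[< forall P : {pred {freeg X / S}}, submod_closed P ->
                 (forall v, tensor_relation v -> v \in P) -> u \in P >].

Fact tensor_relations_submod : submod_closed tensor_relations.
Proof.
split=> [|a u v].
  by apply/asboolP => P [P0 _] _.
move=> /asboolP uP /asboolP vP; apply/asboolP => P Psub Prel.
by case: (Psub) => _; apply; [apply: uP | apply: vP].
Qed.

HB.instance Definition _ := GRing.isSubmodClosed.Build S {freeg X / S}
  tensor_relations tensor_relations_submod.

Definition base_change : Type := Quotient.quot tensor_relations.

HB.instance Definition _ := GRing.Zmodule.on base_change.
HB.instance Definition _ := EqQuotient.on base_change.

Definition base_change_scale (a : S) :=
  lift_op1 base_change (fun u : {freeg X / S} => a *: u).

Fact pi_base_change_scale a :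
  {morph \pi_base_change : u / a *: u >-> base_change_scale a u}.
Proof.
move=> u; unlock base_change_scale; apply/eqP.
rewrite -Quotient.idealrBE -scalerBr rpredZ //.
by rewrite Quotient.idealrBE reprK.
Qed.

Fact base_change_scaleA a b u :
  base_change_scale a (base_change_scale b u) = base_change_scale (a * b) u.
Proof. by rewrite -[u]reprK -!pi_base_change_scale scalerA. Qed.

Fact base_change_scale1 : left_id 1 base_change_scale.
Proof. by move=> u; rewrite -[u]reprK -pi_base_change_scale scale1r. Qed.

Fact base_change_scaleDr : right_distributive base_change_scale +%R.
Proof.
move=> a u v; rewrite -[u]reprK -[v]reprK -!(rmorphD, raddfD) /=.
by rewrite -!pi_base_change_scale scalerDr raddfD.
Qed.

Fact base_change_scaleDl u :
  {morph base_change_scale^~ u : a b / a + b}.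
Proof.
by move=> a b; rewrite -[u]reprK -!pi_base_change_scale scalerDl raddfD.
Qed.

HB.instance Definition _ := GRing.Zmodule_isLmodule.Build S base_change
  base_change_scaleA base_change_scale1 base_change_scaleDr base_change_scaleDl.

Definition tensor (a : S) (x : X) : base_change :=
  \pi_base_change << a *g x >>.

Fact tensor1_semilinear : semilinear_for (f \; *:%R) (tensor 1).
Proof.
split=> [b x|x y]; apply/eqP.
  rewrite /tensor -[X in _ == X]pi_base_change_scale.
  rewrite -Quotient.idealrBE; apply/asboolP => P _; apply.
  have -> : f b *: << x >> = << f b *g x >> :> {freeg X / S}.
    by apply/eqP/freeg_eqP => y; rewrite coeffZ !coeffU mul1r.
  exact: TensorRelZ.
rewrite /tensor -raddfD -Quotient.idealrBE; apply/asboolP => P _; apply.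
exact: TensorRelD.
Qed.

HB.instance Definition _ := GRing.isSemilinear.Build R X base_change
  (f \; *:%R) (tensor 1) tensor1_semilinear.

Lemma tensorE a x : tensor a x = a *: tensor 1 x.
Proof.
rewrite /tensor -[RHS]pi_base_change_scale; congr (\pi _).
by apply/eqP/freeg_eqP => y; rewrite coeffZ !coeffU mul1r.
Qed.

Section Lift.
Variables (M : lmodType S) (h : {linear X -> M | f \; *:%R}).

Lemma fglift_linear : linear (fglift h : {freeg X / S} -> M).
Proof.
have lin0 u v : fglift h (u - v) = fglift h u - fglift h v.
  exact: lift_is_additive.
pose H := GRing.isZmodMorphism.Build {freeg X / S} M (fglift h) lin0.
pose g : {additive {freeg X / S} -> M} := HB.pack (fglift h) H.
have linZ a u : g (a *: u) = a *: g u.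
  have -> : a *: u = \sum_(x <- dom u) << a * coeff x u *g x >> by [].
  rewrite (raddf_sum g) -[RHS]/(a *: fglift h u).
  have -> : fglift h u = \sum_(x <- dom u) g << coeff x u *g x >>.
    by rewrite -(raddf_sum g) freeg_sumE.
  by rewrite scaler_sumr; apply: eq_bigr => x _; rewrite /= !liftU scalerA.
by move=> a u v; rewrite [LHS](raddfD g (a *: u) v) linZ.
Qed.

Definition base_change_lift (u : base_change) : M := fglift h (repr u).

Lemma base_change_lift_pi u :
  base_change_lift (\pi_base_change u) = fglift h u.
Proof.
pose g := HB.pack_for {linear {freeg X / S} -> M} (fglift h : {freeg X / S} -> M)
  (GRing.isLinear.Build _ _ _ _ _ fglift_linear).
pose P : {pred {freeg X / S}} := fun v => g v == 0.
have Psub : submod_closed P.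
  split=> [|a v w]; rewrite !unfold_in ?raddf0 // => /eqP v0 /eqP w0.
  by rewrite linearP v0 w0 scaler0 addr0.
apply/eqP; rewrite -subr_eq0 -[_ - _]/(g _ - g _) -raddfB.
have : repr (\pi_base_change u) - u \in tensor_relations.
  by rewrite Quotient.idealrBE reprK.
move/asboolP/(_ P Psub); apply => _ [x y|b x]; rewrite unfold_in.
  by rewrite !raddfB raddfD /= !liftU !scale1r raddfD subrr.
by rewrite raddfB /= !liftU scale1r linearZ subrr.
Qed.

Fact base_change_lift_linear : linear base_change_lift.
Proof.
move=> a u v; rewrite -[u]reprK -[v]reprK.
rewrite -[a *: _]pi_base_change_scale -raddfD !base_change_lift_pi.
exact: fglift_linear.
Qed.

HB.instance Definition _ := GRing.isLinear.Build S base_change M *:%R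
  base_change_lift base_change_lift_linear.

Lemma base_change_liftE a x : base_change_lift (tensor a x) = a *: h x.
Proof. by rewrite base_change_lift_pi liftU. Qed.

End Lift.

End BaseChange.

Definition base_change_map (R S : comNzRingType) (f : {rmorphism R -> S})
    (X Y : lmodType R) (g : {linear X -> Y}) :
    {linear base_change f X -> base_change f Y} :=
  base_change_lift (tensor f 1 \o g).

Lemma base_change_mapE (R S : comNzRingType) (f : {rmorphism R -> S})
    (X Y : lmodType R) (g : {linear X -> Y}) a x :
  base_change_map f g (tensor f a x) = tensor f a (g x).
Proof. by rewrite [LHS]base_change_liftE /= -tensorE. Qed.

Record quiver := Quiver {
  vert : finType;
  edge : finType;
  src : edge -> vert;
  tgt : edge -> vert
}.

Section UnderlyingGraph.
Local Open Scope nat_scope.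
Variable Q : quiver.

(* Multiplicity of the undirected edge u - v (number of loops when u = v). *)
Definition multiplicity (u v : vert Q) : nat :=
  #|[set e : edge Q | [set src e; tgt e] == [set u; v]]|.

Definition quiver_connected : Prop :=
  0 < #|vert Q| /\
  forall u v : vert Q, connect (fun a b => 0 < multiplicity a b) u v.

(* The underlying multigraph is isomorphic to the simple graph on             *)
(* {0, ..., n - 1} with an edge i - j whenever r i j or r j i.                *)
Definition underlying_graph_is (n : nat) (r : rel nat) : Prop :=
  exists f : vert Q -> 'I_n, bijective f /\
    forall u v, multiplicity u v = (r (f u) (f v) || r (f v) (f u)).

(* 0 - 1 - ... - (n-1) *)
Definition chain : rel nat := fun i j => j == i.+1.

(* 0 - 1 - ... - (n-2), and n-1 attached to b *)
Definition chain_with_leaf (n b : nat) : rel nat :=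
  fun i j => ((j == i.+1) && (j < n.-1)) || ((i == b) && (j == n.-1)).

Definition type_A : Prop := exists2 n, 1 <= n & underlying_graph_is n chain.
Definition type_D : Prop :=
  exists2 n, 4 <= n & underlying_graph_is n (chain_with_leaf n (n - 3)).
Definition type_E : Prop :=
  exists2 n, 6 <= n <= 8 & underlying_graph_is n (chain_with_leaf n 2).
Definition type_ADE : Prop := [\/ type_A, type_D | type_E].

End UnderlyingGraph.

(* Group law of Aut(Q): a * b = a \o b, so that a homomorphism into it is a   *)
(* left action; {perm T} uses the opposite convention (s * t) x = t (s x).    *)

Section QuiverAut.
Variable Q : quiver.

Definition is_quiver_aut (a : {perm vert Q} * {perm edge Q}) : bool :=
  [forall e, (src (a.2 e) == a.1 (src e)) && (tgt (a.2 e) == a.1 (tgt e))].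

Record quiver_aut :=
  QuiverAut { aut_perms :> {perm vert Q} * {perm edge Q};
              quiver_autP : is_quiver_aut aut_perms }.

HB.instance Definition _ := [isSub for aut_perms].
HB.instance Definition _ := [Choice of quiver_aut by <:].

Lemma aut_src (a : quiver_aut) e : src (a.2 e) = a.1 (src e).
Proof. by have /forallP/(_ e)/andP[/eqP] := quiver_autP a. Qed.
Lemma aut_tgt (a : quiver_aut) e : tgt (a.2 e) = a.1 (tgt e).
Proof. by have /forallP/(_ e)/andP[_ /eqP] := quiver_autP a. Qed.

Fact is_quiver_aut1 : is_quiver_aut (1%g, 1%g).
Proof. by apply/forallP => e; rewrite !perm1 !eqxx. Qed.

Fact is_quiver_autM (a b : quiver_aut) :
  is_quiver_aut ((b.1 * a.1)%g, (b.2 * a.2)%g).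
Proof. by apply/forallP => e; rewrite !permM !(aut_src, aut_tgt) !eqxx. Qed.

Fact is_quiver_autV (a : quiver_aut) : is_quiver_aut ((a.1)^-1%g, (a.2)^-1%g).
Proof.
apply/forallP => e /=.
rewrite -(inj_eq (@perm_inj _ a.1)) -aut_src !permKV eqxx /=.
by rewrite -(inj_eq (@perm_inj _ a.1)) -aut_tgt !permKV eqxx.
Qed.

Definition aut1 := QuiverAut is_quiver_aut1.
Definition autM a b := QuiverAut (is_quiver_autM a b).
Definition autV a := QuiverAut (is_quiver_autV a).

Lemma eq_aut (a b : quiver_aut) : a.1 = b.1 -> a.2 = b.2 -> a = b.
Proof.
move=> ab1 ab2; apply: val_inj.
by rewrite [LHS]surjective_pairing ab1 ab2 -surjective_pairing.
Qed.

Fact autMA : associative autM.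
Proof. by move=> a b c; apply: eq_aut; rewrite [LHS]/= [RHS]/= mulgA. Qed.
Fact aut1M : left_id aut1 autM.
Proof. by move=> a; apply: eq_aut; rewrite [LHS]/= mulg1. Qed.
Fact autM1 : right_id aut1 autM.
Proof. by move=> a; apply: eq_aut; rewrite [LHS]/= mul1g. Qed.
Fact autVM : left_inverse aut1 autV autM.
Proof. by move=> a; apply: eq_aut; rewrite [LHS]/= mulgV. Qed.
Fact autMV : right_inverse aut1 autV autM.
Proof. by move=> a; apply: eq_aut; rewrite [LHS]/= mulVg. Qed.

HB.instance Definition _ :=
  isGroup.Build quiver_aut autMA aut1M autM1 autVM autMV.

End QuiverAut.

Section RationalStructure.
Variables (F L : fieldType) (i : {rmorphism F -> L}) (Q : quiver).

Definition vact (rho : Gal i -> quiver_aut Q) (s : Gal i) (v : vert Q) : vert Q :=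
  (rho s).1 v.
Definition eact (rho : Gal i -> quiver_aut Q) (s : Gal i) (e : edge Q) : edge Q :=
  (rho s).2 e.

Record rational_structure := RationalStructure {
  rational_hom :> {multiplicative Gal i -> quiver_aut Q};
  vact_continuous :
    continuous (fun p : Gal i * discrete_topology (vert Q) =>
                  vact rational_hom p.1 p.2 : discrete_topology (vert Q));
  eact_continuous :
    continuous (fun p : Gal i * discrete_topology (edge Q) =>
                  eact rational_hom p.1 p.2 : discrete_topology (edge Q))
}.

Lemma vactM (rho : rational_structure) s t v :
  vact rho (s * t)%g v = vact rho s (vact rho t v).
Proof. by rewrite /vact gmulfM /= permM. Qed.
Lemma src_eact (rho : rational_structure) s e :
  src (eact rho s e) = vact rho s (src e).
Proof. exact: aut_src. Qed.
Lemma tgt_eact (rho : rational_structure) s e :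
  tgt (eact rho s e) = vact rho s (tgt e).
Proof. exact: aut_tgt. Qed.

End RationalStructure.

Section Restriction.
Variables (K F L : fieldType) (Q : quiver).
Variables (iK : {rmorphism K -> L}) (iF : {rmorphism F -> L}).
Variable j : {rmorphism K -> F}.
Hypothesis tower : forall x, iF (j x) = iK x.
Variable rho : rational_structure iK Q.

Definition restr_fun (s : Gal iF) : quiver_aut Q := rho (gal_incl tower s).

Fact restr_funM : {morph restr_fun : s t / (s * t)%g >-> (s * t)%g}.
Proof. by move=> s t; rewrite /restr_fun gal_inclM gmulfM. Qed.

HB.instance Definition _ := isMultiplicative.Build _ _ restr_fun restr_funM.

Fact restr_continuous (T : choiceType) (a : Gal iK -> T -> T) :
  continuous (fun p : Gal iK * discrete_topology T =>
                a p.1 p.2 : discrete_topology T) ->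
  continuous (fun p : Gal iF * discrete_topology T =>
                a (gal_incl tower p.1) p.2 : discrete_topology T).
Proof.
move=> a_cont p.
apply: (@continuous_comp _ _ _
  (fun p : Gal iF * discrete_topology T =>
     (gal_incl tower p.1, p.2) : Gal iK * discrete_topology T)
  (fun p => a p.1 p.2 : discrete_topology T)); last exact: a_cont.
move=> U [[A B] /= [nA nB] AB].
exists (gal_incl tower @^-1` A, B)%classic => /=.
  by split=> //; apply: gal_incl_continuous nA.
by move=> [s x] /= [As Bx]; apply: AB.
Qed.

Definition rational_restr : rational_structure iF Q :=
  @RationalStructure _ _ iF Q restr_fun
    (@restr_continuous _ (vact rho) (@vact_continuous _ _ _ _ rho))
    (@restr_continuous _ (eact rho) (@eact_continuous _ _ _ _ rho)).

End Restriction.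

Record representation (L : fieldType) (Q : quiver) := Representation {
  rep_space :> vert Q -> lmodType L;
  rep_map : forall e : edge Q, {linear rep_space (src e) -> rep_space (tgt e)}
}.

Section Representations.
Variables (L : fieldType) (Q : quiver).
Implicit Types W : representation L Q.

(* W_e with its source and target rewritten along equalities of vertices. *)
Definition rep_map_at W (e : edge Q) (u v : vert Q)
    (eu : src e = u) (ev : tgt e = v) : {linear W u -> W v} :=
  match eu in _ = u', ev in _ = v' return {linear W u' -> W v'} with
  | erefl, erefl => rep_map W e
  end.

Definition is_subrep W (U : forall v, {pred W v}) : Prop :=
  (forall v, submod_closed (U v)) /\
  (forall (e : edge Q) x, x \in U (src e) -> rep_map W e x \in U (tgt e)).

Definition irreducible_rep W : Prop :=
  (exists v, exists x : W v, x != 0) /\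
  (forall U : forall v, {pred W v}, is_subrep U ->
     (forall v x, x \in U v -> x = 0) \/ (forall v x, x \in U v)).

Definition rep_iso W W' : Prop :=
  exists f : forall v, {linear W v -> W' v},
    (forall v, bijective (f v)) /\
    (forall (e : edge Q) x,
       f (tgt e) (rep_map W e x) = rep_map W' e (f (src e) x)).

End Representations.

Section RationalRepresentations.
Variables (F L : fieldType) (i : {rmorphism F -> L}) (Q : quiver).
Variable rho : rational_structure i Q.

(* W^s (v) = L (x)_{s, L} W (s^-1 v) and (W^s)_e = id (x) W_{s^-1 e} *)
Definition conj_rep (s : Gal i) (W : representation L Q) : representation L Q :=
  @Representation L Q
    (fun v => base_change s (W (vact rho s^-1%g v)))
    (fun e => base_change_map s
       (rep_map_at W (src_eact rho s^-1%g e) (tgt_eact rho s^-1%g e))).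

Record rational_rep := RationalRep {
  underlying_rep :> representation L Q;
  gal_map : forall (v : vert Q) (s : Gal i),
    {linear underlying_rep v -> underlying_rep (vact rho s v) | s \; *:%R};
  gal_map_bij : forall v s, bijective (gal_map v s);
  gal_map_comp : forall s t v x,
    gal_map (vact rho t v) s (gal_map v t x) =
      ecast u (underlying_rep u) (vactM rho s t v) (gal_map v (s * t)%g x);
  gal_map_edge : forall s e x,
    rep_map_at underlying_rep (src_eact rho s e) (tgt_eact rho s e)
        (gal_map (src e) s x) =
      gal_map (tgt e) s (rep_map underlying_rep e x)
}.

End RationalRepresentations.

(* Main.v *)
Require Import Defs.
From HB Require Import structures.
From mathcomp Require Import all_boot all_algebra.
From mathcomp Require Import perm boolp freeg zify.

(* The underlying graph is a tree, so any nonempty set of vertices contains a *)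
(* vertex without an arrow into the set.  For the support of an irreducible   *)
(* representation W, such a vertex carries a subrepresentation; hence W is a  *)
(* line concentrated at a single vertex v0.  Invariance of W under            *)
(* conjugation forces the Galois group to fix v0, so the action of Gal(L/F)   *)
(* on L itself, placed at v0, is an F-rational form of W.                     *)

Set Implicit Arguments.
Unset Strict Implicit.
Unset Printing Implicit Defensive.

Import GRing.Theory.
Local Open Scope ring_scope.

(** [has_sinks] expresses the absence of oriented cycles; a tree has none, whatever the orientation
    ([ADE_has_sinks]). Over such a quiver an irreducible W is a copy of L at one vertex with all
    maps zero ([irreducible_rep_line]). There is no Brauer obstruction because L carries its own
    Galois action, which satisfies the composition rule exactly; [line_rational_rep] is the
    resulting form. *)

Definition has_sinks (Q : quiver) : Prop :=
  forall S : {set vert Q}, S != finset.set0 ->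
    exists2 v, v \in S & forall e, src e = v -> tgt e \notin S.

Section Sinks.
Local Open Scope nat_scope.

(* r i j says that i is the parent of j. *)
Lemma forest_has_sinks (Q : quiver) (n : nat) (r : rel nat) :
  underlying_graph_is Q n r ->
  (forall i j, r i j -> i < j) ->
  (forall i i' j, r i j -> r i' j -> i = i') ->
  has_sinks Q.
Proof.
case=> f [/bij_inj f_inj mult] r_lt r_parent S.
have adj e : r (f (src e)) (f (tgt e)) || r (f (tgt e)) (f (src e)).
  rewrite -[_ || _]lt0b -mult card_gt0; apply/set0Pn; exists e.
  by rewrite inE.
have loopless (e : edge Q) : src e != tgt e.
  apply/eqP => eq_st; have := adj e.
  by rewrite -eq_st orbb => /r_lt; rewrite ltnn.
have [k] := ubnP #|S|; elim: k S => // k IHk S.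
move=> S_k /set0Pn[m0 m0S].
(* Since its label is maximal, [m] has no neighbour in S except possibly its parent. *)
case: (arg_maxnP (fun v => f v : nat) m0S) => m mS m_max.
have [[e [em eS]]|no_e] := pselect (exists e, src e = m /\ tgt e \in S);
  last first.
  by exists m => // e em; apply/negP => eS; apply: no_e; exists e.
have e_ne : tgt e != m by rewrite -em eq_sym.
have r_em : r (f (tgt e)) (f m).
  have := adj e; rewrite em => /orP[/r_lt|//].
  by rewrite ltnNge [_ <= _]m_max.
(* The only arrow between [m] and S leaves [m], so a sink of the remaining set is a sink of S. *)
have [||v] := IHk (S :\ m)%SET.
- by move: S_k; rewrite (cardsD1 m) [m \in S]mS.
- by apply/set0Pn; exists (tgt e); rewrite !inE e_ne.
rewrite !inE => /andP[v_ne vS] v_sink; exists v => // e' ev.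
(* An edge e' from v back to m joins m to its parent, hence is e itself. *)
apply/negP => e'S; have := v_sink e' ev; rewrite !inE e'S andbT negbK => /eqP e'm.
have r_e'm : r (f v) (f m).
  have := adj e'; rewrite ev e'm => /orP[//|/r_lt].
  by rewrite ltnNge [_ <= _]m_max.
have v_e : v = tgt e by apply/f_inj/val_inj/(r_parent _ _ _ r_e'm r_em).
suff ee' : e = e' by rewrite -ev -ee' em eqxx in v_ne.
have : #|[set e0 : edge Q | [set src e0; tgt e0] == [set m; v]]%SET| <= 1.
  by rewrite [X in X <= 1]mult leq_b1.
by move=> /card_le1_eqP; apply; rewrite inE ?em ?ev ?e'm -?v_e // finset.setUC.
Qed.

(** In these numberings each j > 0 has exactly one smaller neighbour: j - 1, or the branching vertex
    when j is the attached leaf. *)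
Lemma ADE_has_sinks (Q : quiver) : type_ADE Q -> has_sinks Q.
Proof.
case=> [[n n_ge]|[n n_ge]|[n n_ge]] /forest_has_sinks; apply;
  rewrite /chain /chain_with_leaf; lia.
Qed.

End Sinks.

Section IrreducibleRep.
Variables (L : fieldType) (Q : quiver) (W : representation L Q).

(** At a sink [v0] of the support all outgoing maps vanish, so W(v0) alone is a subrepresentation,
    hence all of W. All maps are then zero, so a line in W(v0) is again a subrepresentation. *)
Lemma irreducible_rep_line : has_sinks Q -> irreducible_rep W ->
  exists v0 (w : forall v, W v),
    [/\ w v0 != 0, forall v (x : W v), v != v0 -> x = 0
      & forall v (x : W v), exists a, x = a *: w v].
Proof.
move=> Q_sinks [[v1 [x1 x1_neq0]] irrW].
pose S := [set v | `[< exists x : W v, x != 0 >]]%SET.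
have S_n0 : S != finset.set0.
  by apply/set0Pn; exists v1; rewrite inE; apply/asboolP; exists x1.
have [v0] := Q_sinks S S_n0; rewrite inE => /asboolP[x0 x0_neq0] v0_sink.
have tgt0 e (x : W (tgt e)) : src e = v0 -> x = 0.
  move=> /v0_sink; rewrite inE => /asboolPn notS; apply/eqP/negPn/negP => x_neq0.
  by apply: notS; exists x.
have conc v (x : W v) : v != v0 -> x = 0.
  pose U v : {pred W v} := [pred x | (v == v0) || (x == 0)].
  move=> v_ne; case: (irrW U) => [|U0|U1].
  - split=> [u|e y]; first split=> [|a y z]; rewrite !inE ?eqxx ?orbT //.
      by case: eqP => //= _ /eqP-> /eqP->; rewrite scaler0 addr0.
    case/orP=> [/eqP/tgt0 t0|/eqP->]; last by rewrite raddf0 eqxx orbT.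
    by rewrite (t0 (rep_map W e y)) eqxx orbT.
  - by case/eqP: x0_neq0; apply: U0; rewrite inE eqxx.
  - by have := U1 v x; rewrite inE (negPf v_ne) => /eqP.
(* Choosing a vector at every vertex avoids transporting [x0] along v = v0 later. *)
have w_ex v : exists w : W v, v = v0 -> w != 0.
  case: (eqVneq v v0) => [->|/eqP v_ne]; first by exists x0.
  by exists 0.
pose w v := projT1 (cid (w_ex v)).
have w_neq0 : w v0 != 0 by rewrite /w; case: cid => y /= ->.
exists v0, w; split=> // v x.
pose U v : {pred W v} := fun x => `[< exists a, x = a *: w v >].
case: (irrW U) => [|U0|U1].
- split=> [u|e y _].
    split=> [|a _ _ /asboolP[b ->] /asboolP[c ->]]; apply/asboolP.
      by exists 0; rewrite scale0r.
    by exists (a * b + c); rewrite scalerDl scalerA.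
  apply/asboolP; exists 0; rewrite scale0r.
  have [e_src|se_ne] := eqVneq (src e) v0; first exact: tgt0.
  by rewrite (conc _ y se_ne) raddf0.
- case/eqP: w_neq0; apply: U0; apply/asboolP; exists 1.
  by rewrite scale1r.
- by apply/asboolP; apply: U1.
Qed.

End IrreducibleRep.

Lemma base_change_eq0 (R S : comNzRingType) (f : {rmorphism R -> S})
    (X : lmodType R) : (forall x : X, x = 0) ->
  forall u : base_change f X, u = 0.
Proof.
move=> X0 u; rewrite -[u]reprK -(freeg_sumE (repr u)) raddf_sum big1 // => x _.
by rewrite -[LHS]/(tensor f _ x) (X0 x) tensorE raddf0 scaler0.
Qed.

Section CoordinateLine.
Variables (L : fieldType) (b : bool) (V : lmodType L) (w : V).

(** The sum has [b] terms, none or one, so a single formula parametrizes both the zero space and a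
    line. *)
Definition row_line (x : 'rV[L]_b) : V := (\sum_j x 0 j) *: w.

Fact row_line_linear : linear row_line.
Proof.
move=> a x y; rewrite /row_line scalerA -scalerDl mulr_sumr -big_split /=.
by congr (_ *: _); apply: eq_bigr => j _; rewrite !mxE.
Qed.

HB.instance Definition _ :=
  GRing.isLinear.Build L 'rV[L]_b V *:%R row_line row_line_linear.

Lemma row_line_bij : (w != 0) = b -> (forall x, exists a, x = a *: w) ->
  bijective row_line.
Proof.
move=> wb w_span.
have f_inj : injective row_line.
  apply: raddf_inj => x; rewrite -[_ x]/((\sum_j x 0 j) *: w).
  case: b wb x => wb x; last by move=> _; apply/rowP => -[].
  rewrite big_ord1 => /eqP; rewrite scaler_eq0 (negPf wb) orbF => /eqP x0.
  by apply/rowP => j; rewrite ord1 x0 mxE.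
have f_surj y : exists x, row_line x = y.
  have [a ->] := w_span y; exists (const_mx a); rewrite /row_line.
  case: b wb => wb; first by rewrite big_ord1 mxE.
  by move/negbFE/eqP: wb => ->; rewrite !scaler0.
pose g y := projT1 (cid (f_surj y)).
have gK : cancel g row_line by move=> y; rewrite /g; case: cid.
by exists g => //; apply: inj_can_sym.
Qed.

End CoordinateLine.

Section LineAtFixedVertex.
Variables (F L : fieldType) (i : {rmorphism F -> L}) (Q : quiver).
Variables (rho : rational_structure i Q) (v0 : vert Q).
Hypothesis v0_fix : forall s, vact rho s v0 = v0.

(* L at v0 and 0 elsewhere: the dimension is the truth value of v == v0. *)
Definition line_rep : representation L Q :=
  @Representation L Q (fun v => 'rV[L]_(v == v0)) (fun e => \0).

Fact vact_eq_fixed s v : (v == v0) = (vact rho s v == v0) :> nat.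
Proof. by rewrite -{2}(v0_fix s) (inj_eq perm_inj). Qed.

(** The cast exists because [v0] is fixed: [v] and its translate carry spaces of equal dimension. *)
Definition line_gal v s (x : line_rep v) : line_rep (vact rho s v) :=
  castmx (erefl, vact_eq_fixed s v) (map_mx s x).

Fact line_gal_semilinear v (s : Gal i) :
  semilinear_for (s \; *:%R) (@line_gal v s).
Proof.
by split=> [a x|x y]; apply/rowP => j; rewrite !(mxE, castmxE) ?rmorphM ?rmorphD.
Qed.

HB.instance Definition _ v s := GRing.isSemilinear.Build L (line_rep v)
  (line_rep (vact rho s v)) (s \; *:%R) (@line_gal v s)
  (line_gal_semilinear v s).

Fact line_gal_bij v s : bijective (@line_gal v s).
Proof.
exists (fun y => map_mx (galV s) (castmx (erefl, esym (vact_eq_fixed s v)) y)).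
  move=> x; apply/rowP => j; rewrite !(mxE, castmxE) /= galK.
  by congr (x _ _); apply: val_inj.
move=> y; apply/rowP => j; rewrite !(mxE, castmxE) /= galKV.
by congr (y _ _); apply: val_inj.
Qed.

Fact line_gal_comp s t v (x : line_rep v) :
  line_gal s (line_gal t x) =
    ecast u (line_rep u) (vactM rho s t v) (line_gal (s * t)%g x).
Proof.
(* Transport along an equality of vertices only relabels coordinates, keeping index values. *)
have castE u u' (e : u = u') (y : line_rep u) j :
    (ecast u (line_rep u) e y : 'rV_(u' == v0)) 0 j =
      y 0 (cast_ord (congr1 (fun u => nat_of_bool (u == v0)) (esym e)) j).
  by case: u' / e j => j /=; congr (y 0 _); apply: val_inj.
apply/rowP => j; rewrite castE /line_gal !(mxE, castmxE) /=.
by congr (s (t (x _ _))); apply: val_inj.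
Qed.

Lemma rep_map_at_eq0 (W : representation L Q) e :
  (forall x, rep_map W e x = 0) ->
  forall u v (eu : src e = u) (ev : tgt e = v) x, rep_map_at W eu ev x = 0.
Proof. by move=> We0 u v eu ev; case: u / eu; case: v / ev. Qed.

Fact line_gal_edge s e (x : line_rep (src e)) :
  rep_map_at line_rep (src_eact rho s e) (tgt_eact rho s e) (line_gal s x) =
    line_gal s (rep_map line_rep e x).
Proof. by rewrite rep_map_at_eq0 //= raddf0. Qed.

Definition line_rational_rep : rational_rep rho :=
  @RationalRep _ _ _ _ rho line_rep (fun v s => @line_gal v s)
    line_gal_bij line_gal_comp line_gal_edge.

End LineAtFixedVertex.

Theorem corollary2p2
  (K L : fieldType) (iK : {rmorphism K -> L})
  (charK : [pchar K]%R =i pred0)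
  (galLK : galois_extension iK)
  (Q : quiver) (connQ : quiver_connected Q) (adeQ : type_ADE Q)
  (rho : rational_structure iK Q)
  (F : fieldType) (jKF : {rmorphism K -> F}) (iF : {rmorphism F -> L})
  (tower : forall x : K, iF (jKF x) = iK x)
  (W : representation L Q)
  (irrW : irreducible_rep W)
  (invW : forall s : Gal iF, rep_iso (conj_rep (rational_restr tower rho) s W) W) :
  exists M : rational_rep (rational_restr tower rho),
    rep_iso (underlying_rep M) W.
Proof.
have Q_sinks := ADE_has_sinks adeQ.
have [v0 [w [w_neq0 W0 w_span]]] := irreducible_rep_line Q_sinks irrW.
have edge0 e (x : W (src e)) : rep_map W e x = 0.
  have [e_src|e_src] := eqVneq (src e) v0; last by rewrite (W0 _ x e_src) raddf0.
  apply: W0; apply/eqP => e_tgt.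
  (* On a singleton, [has_sinks] excludes loops. *)
  have [|v] := Q_sinks [set v0]%SET; first by apply/set0Pn; exists v0; rewrite inE.
  by rewrite inE => /eqP-> /(_ e e_src); rewrite inE e_tgt eqxx.
set rhoF := rational_restr tower rho in invW *.
(* Otherwise W^s(v0) is the base change of a zero space, yet it is isomorphic to W(v0), which
   contains [w v0]. *)
have v0_fixV s : vact rhoF s^-1%g v0 = v0.
  apply/eqP/negPn/negP => v0_moved; have [f [f_bij _]] := invW s.
  have [g _ gK] := f_bij v0; case/eqP: w_neq0; rewrite -[w v0]gK.
  rewrite [g _](_ : _ = 0) ?raddf0 //; apply: base_change_eq0 => x.
  exact: W0.
have v0_fix s : vact rhoF s v0 = v0 by rewrite -[s]invgK v0_fixV.
exists (line_rational_rep v0_fix), (fun v => row_line (w v)); split=> [v|e x].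
  apply: row_line_bij; last exact: w_span.
  have [->//|v_ne] := eqVneq v v0.
  by rewrite (W0 _ (w v) v_ne) eqxx.
by rewrite [RHS]edge0 [LHS]raddf0.
Qed.
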